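(* The Einstein metric on $SL(3)/GL(2)$, given in local coordinates $(x^A,z_A)$, $A=0,1$, by $$g=dz_A\odot dx^A+z_Az_B\,dx^A\odot dx^B,$$ is pseudo-hyper-Hermitian.
   Context: Here $SL(3)/GL(2)$ (over $\mathbb{R}$) is identified with the set of non-incident pairs $(P,L)$ of a point $P\in\mathbb{RP}^2$ and a line $L\subset\mathbb{RP}^2$, and $(x^A,z_A)$ are the local affine coordinates $P=[x^A,1]$, $L=[z_A,1-x^Az_A]$; the assertion is local, in this coordinate patch. The symmetric product is $a\odot b=\frac12(a\otimes b+b\otimes a)$, with summation over repeated indices. A pseudo-hyper-complex structure on a four-manifold $M$ is a triple of endomorphisms $I,S,T$ of $TM$ satisfying $I^2=-\mathrm{Id}$, $S^2=T^2=\mathrm{Id}$, $IST=\mathrm{Id}$, and such that $aI+bS+cT$ is an integrable complex structure for every point of the hyperboloid $a^2-b^2-c^2=1$. A neutral signature metric $g$ on a pseudo-hyper-complex four-manifold is pseudo-hyper-Hermitian if $g(V,V)=g(IV,IV)=-g(SV,SV)=-g(TV,TV)$ for any vector field $V$. A metric is called pseudo-hyper-Hermitian if a pseudo-hyper-complex structure with this property exists. *)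

(* Defs.v *)
From HB Require Import structures.
From mathcomp Require Import all_boot all_order all_algebra.
From mathcomp Require Import all_classical all_reals all_analysis.
Set Implicit Arguments.
Unset Strict Implicit.
Unset Printing Implicit Defensive.
Import Order.TTheory GRing.Theory Num.Theory.
Import numFieldNormedType.Exports.
Local Open Scope classical_set_scope.
Local Open Scope ring_scope.

(* Four-manifolds are open subsets [U] of R^4 (a coordinate patch).  The
   tangent space at every point is identified with the column vectors
   ['cV[R]_4] by the coordinate frame; a field of endomorphisms of TM is a
   field of matrices acting on columns from the left, and a metric is the field
   of its Gram matrices. *)

Fixpoint is_Ck (R : realType) (V W : normedModType R) (k : nat) (U : set V)
    (f : V -> W) : Prop :=
  match k with
  | 0 => forall p, U p -> {for p, continuous f}
  | k'.+1 => (forall p, U p -> differentiable f p) /\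
             (forall v, is_Ck k' U (fun p => 'D_v f p))
  end.

Definition smooth (R : realType) (V W : normedModType R) (U : set V)
    (f : V -> W) : Prop :=
  forall k, is_Ck k U f.

(* Multiplication by the imaginary unit on C^2 = R^4, with real coordinates
   ordered as (Re u, Re v, Im u, Im v). *)
Definition mul_i (R : realType) : 'M[R]_4 :=
  @block_mx R 2 2 2 2 0 (- 1%:M) 1%:M 0.

(* [phi] is a diffeomorphism from [O] onto an open subset of C^2 which
   intertwines [J] with multiplication by i. *)
Definition holomorphic_chart (R : realType) (J : 'cV[R]_4 -> 'M[R]_4)
    (O : set 'cV[R]_4) (phi : 'cV[R]_4 -> 'cV[R]_4) : Prop :=
  [/\ open O, open (phi @` O), smooth O phi,
      (exists psi : 'cV[R]_4 -> 'cV[R]_4,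
         smooth (phi @` O) psi /\ forall q, O q -> psi (phi q) = q) &
      forall q, O q -> forall v : 'cV[R]_4,
        'D_(J q *m v) phi q = mul_i R *m 'D_v phi q].

(* Integrability is existence of local holomorphic coordinates, not just
   vanishing of the Nijenhuis tensor. *)
Definition integrable_complex_structure (R : realType) (U : set 'cV[R]_4)
    (J : 'cV[R]_4 -> 'M[R]_4) : Prop :=
  [/\ smooth U J,
      (forall p, U p -> J p *m J p = - 1%:M) &
      forall p, U p -> exists (O : set 'cV[R]_4) (phi : 'cV[R]_4 -> 'cV[R]_4),
        [/\ O p, O `<=` U & holomorphic_chart J O phi]].

Definition pseudo_hyper_complex (R : realType) (U : set 'cV[R]_4)
    (I S T : 'cV[R]_4 -> 'M[R]_4) : Prop :=
  [/\ smooth U I /\ smooth U S /\ smooth U T,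
      (forall p, U p -> I p *m I p = - 1%:M),
      (forall p, U p -> S p *m S p = 1%:M /\ T p *m T p = 1%:M),
      (forall p, U p -> I p *m S p *m T p = 1%:M) &
      forall a b c : R, a ^+ 2 - b ^+ 2 - c ^+ 2 = 1 ->
        integrable_complex_structure U
          (fun p => a *: I p + b *: S p + c *: T p)].

Definition neutral_metric (R : realType) (U : set 'cV[R]_4)
    (g : 'cV[R]_4 -> 'M[R]_4) : Prop :=
  [/\ smooth U g,
      (forall p, U p -> (g p)^T = g p) &
      forall p, U p -> exists2 B : 'M[R]_4, B \in unitmx &
        B^T *m g p *m B = @block_mx R 2 2 2 2 1%:M 0 0 (- 1%:M)].

Definition pairing (R : realType) (G : 'M[R]_4) (v w : 'cV[R]_4) : R :=
  (v^T *m G *m w) 0 0.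

Definition pseudo_hyper_hermitian (R : realType) (U : set 'cV[R]_4)
    (g : 'cV[R]_4 -> 'M[R]_4) : Prop :=
  neutral_metric U g /\
  exists I S T : 'cV[R]_4 -> 'M[R]_4,
    pseudo_hyper_complex U I S T /\
    forall V : 'cV[R]_4 -> 'cV[R]_4, smooth U V -> forall p, U p ->
      [/\ pairing (g p) (V p) (V p) =
            pairing (g p) (I p *m V p) (I p *m V p),
          pairing (g p) (V p) (V p) =
            - pairing (g p) (S p *m V p) (S p *m V p) &
          pairing (g p) (V p) (V p) =
            - pairing (g p) (T p *m V p) (T p *m V p)].

(* Coordinates on R^4 are ordered (x^0, x^1, z_0, z_1). *)
Definition x_idx (A : 'I_2) : 'I_4 := @lshift 2 2 A.
Definition z_idx (A : 'I_2) : 'I_4 := @rshift 2 2 A.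

Definition xc (R : realType) (p : 'cV[R]_4) (A : 'I_2) : R := p (x_idx A) 0.
Definition zc (R : realType) (p : 'cV[R]_4) (A : 'I_2) : R := p (z_idx A) 0.

Definition dx (R : realType) (A : 'I_2) : 'rV[R]_4 := delta_mx 0 (x_idx A).
Definition dz (R : realType) (A : 'I_2) : 'rV[R]_4 := delta_mx 0 (z_idx A).

Definition sym_prod (R : realType) (a b : 'rV[R]_4) : 'M[R]_4 :=
  2^-1 *: (a^T *m b + b^T *m a).

Definition sl3_gl2_metric (R : realType) (p : 'cV[R]_4) : 'M[R]_4 :=
  \sum_(A < 2) sym_prod (dz R A) (dx R A) +
  \sum_(A < 2) \sum_(B < 2)
    (zc p A * zc p B) *: sym_prod (dx R A) (dx R B).

(* Homogeneous coordinates of P = [x^A, 1] and L = [z_A, 1 - x^A z_A].  The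
   pair is non-incident for all values of (x, z), so the coordinate patch of
   SL(3)/GL(2) is the whole of R^4. *)
Definition point_P (R : realType) (p : 'cV[R]_4) : 'cV[R]_(2 + 1) :=
  col_mx (\col_A xc p A) 1%:M.

Definition line_L (R : realType) (p : 'cV[R]_4) : 'rV[R]_(2 + 1) :=
  row_mx (\row_A zc p A) (1 - \sum_(A < 2) xc p A * zc p A)%:M.

Lemma line_L_point_P (R : realType) (p : 'cV[R]_4) :
  line_L p *m point_P p = 1%:M.
Proof.
rewrite mul_row_col mulmx1; apply/matrixP => i j; rewrite !ord1 !mxE /=.
rewrite mulr1n (eq_bigr (fun A => xc p A * zc p A)) ?subrKC //.
by move=> A _; rewrite !mxE mulrC.
Qed.

(* Main.v *)
Require Import Defs.
From mathcomp Require Import all_boot all_order all_algebra.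
From mathcomp Require Import all_classical all_reals all_analysis.
From mathcomp Require Import ring lra.
Set Implicit Arguments.
Unset Strict Implicit.
Unset Printing Implicit Defensive.
Import Order.TTheory GRing.Theory Num.Theory.
Import numFieldNormedType.Exports.
Local Open Scope classical_set_scope.
Local Open Scope ring_scope.

(** Put e_A = dz_A + z_A z_B dx^B.  Then g = e_A . dx^A (symmetric product), so
    that in the coframe (dx^A, e_A) the metric is the constant pairing of R^2
    with its dual ([metric_coframe]).  A real 2x2 matrix j acts on the sum of
    R^2 and its dual by j on the first summand and -j^T on the second; if
    j^2 is a scalar h, this action squares to h ([lift_sl2_sqr]) and multiplies
    the metric by -h ([pairing_lift_sl2]).  The traceless matrices

      i = [0, -1; 1, 0],    s = [1, 0; 0, -1],    t = [0, 1; 1, 0]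

    satisfy i^2 = -1, s^2 = t^2 = 1 and i s t = 1, so their actions are the
    endomorphisms I, S, T, and aI + bS + cT is the action of the traceless
    matrix j = ai + bs + ct, whose square is b^2 + c^2 - a^2.

    The substance is integrability, which comes from twistor theory.  The
    twistor space of SL(3)/GL(2) consists of the flags (p, l), with p a point of
    the line l; the pair (P, L) corresponds to the curve of flags such that l
    passes through P and p is the intersection of l and L.  The slope of l maps
    each of these curves bijectively to CP^1.  For a fixed non-real slope tau,
    sending a real pair (P, L) to the flag of slope tau on its curve therefore
    identifies the four-manifold with an open part of the complex surface of
    flags of slope tau, and holomorphic coordinates of the flag become complex
    coordinates of (P, L).  The slope that belongs to j is given by an
    eigenvector: (1, tau) has eigenvalue -i for tau = (b + i) / (a - c).

    Explicitly, let zeta = z_0 + tau z_1.  The line l through x with direction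
    (1, tau) is labelled by u = x^1 - tau x^0, and it meets L where the first
    affine coordinate is x^0 - 1/zeta.  This is infinite at z = 0, so the
    coordinate on l used near a point with x^0 = e is

      v = 1 / (x^0 - e - 1/zeta) = zeta / ((x^0 - e) zeta - 1).

    Up to a factor, dv is dzeta + zeta^2 dx^0 = (e_0 + tau e_1) - zeta z_1 du.
    Both e_0 + tau e_1 and du are multiplied by the imaginary unit when composed
    with J, because (1, tau) is an eigenvector; hence so is dv.  For given x^0
    the map from zeta to v is an involution, which makes the inverse of the
    chart (u, v) explicit, hence smooth ([chartK], [chart_invK]).  Everything is
    a rational function of the coordinates, with a denominator that is the
    squared modulus of (x^0 - e) zeta - 1. *)

(** * Calculus of smooth functions *)

(** In the induction proofs for products and inverses, the derivative of the
    result again contains the undifferentiated functions, one order of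
    smoothness lower. *)
Lemma is_Ck_leS (R : realType) (V W : normedModType R) (k : nat) (U : set V)
    (f : V -> W) :
  is_Ck k.+1 U f -> is_Ck k U f.
Proof.
elim: k f => [|k IH] f [fd fD].
  by move=> p Up; exact/differentiable_continuous/fd.
by split=> // v; exact/IH/fD.
Qed.

Lemma differentiable_near_eq (R : realType) (V W : normedModType R) (f g : V -> W)
    (p : V) :
  (\forall q \near p, f q = g q) -> differentiable f p -> differentiable g p.
Proof.
move=> fg /diff_locallyP[cd /eqaddoP fo].
have fg0 : \forall h \near 0, f (h + p) = g (h + p).
  by move: fg; rewrite (near_shift 0) subr0.
have go : g \o shift p = cst (g p) + 'd f p +o_ 0 id.
  apply/eqaddoP => e e0; have := fo e e0; apply: filterS2 fg0 => h /= fgh.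
  by rewrite !fctE /= /shift /cst fgh (nbhs_singleton fg).
have dgf := diff_unique cd go; by apply/diff_locallyP; rewrite dgf.
Qed.

(** Openness of the set lets equality on it pass to derivatives at its points,
    so that a derivative may be replaced by its closed formula. *)
Lemma is_Ck_ext (R : realType) (V W : normedModType R) (k : nat) (U : set V)
    (f g : V -> W) :
  open U -> (forall p, U p -> f p = g p) -> is_Ck k U f -> is_Ck k U g.
Proof.
move=> oU; elim: k f g => [|k IH] f g fg /=.
  move=> fc p Up; have fgp : \forall q \near p, f q = g q.
    by near=> q; apply: fg; near: q; exact: open_nbhs_nbhs.
  change (g @ p --> g p); rewrite -(fg _ Up).
  by apply: cvg_trans (fc p Up); apply: near_eq_cvg; move: fgp; apply: filterS.
move=> [fd fD]; split.
  move=> p Up; have fgp : \forall q \near p, f q = g q.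
    by near=> q; apply: fg; near: q; exact: open_nbhs_nbhs.
  exact: differentiable_near_eq fgp (fd p Up).
move=> v; apply: (IH ('D_v f)); last exact: fD.
move=> p Up; apply: near_eq_derive.
by near=> q; apply: fg; near: q; exact: open_nbhs_nbhs.
Unshelve. all: by end_near. Qed.

Lemma is_Ck_cst (R : realType) (V W : normedModType R) (k : nat) (U : set V)
    (w : W) :
  is_Ck k U (fun=> w).
Proof.
elim: k w => [|k IH] w /=; first by move=> p _; exact: cvg_cst.
split=> [p _|v]; first exact: differentiable_cst.
have -> : (fun p : V => 'D_v (fun=> w) p) = fun=> 0; last exact: IH.
by apply/funext => p; rewrite derive_cst.
Qed.

Lemma is_CkD (R : realType) (V W : normedModType R) (k : nat) (U : set V)
    (f g : V -> W) : open U ->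
  is_Ck k U f -> is_Ck k U g -> is_Ck k U (fun p => f p + g p).
Proof.
move=> oU; elim: k f g => [|k IH] f g.
  by move=> fc gc p Up; apply: cvgD; [exact: fc|exact: gc].
move=> [fd fD] [gd gD]; split.
  by move=> p Up; apply: differentiableD; [exact: fd|exact: gd].
move=> v; apply: is_Ck_ext (IH _ _ (fD v) (gD v)) => // p Up.
by rewrite -deriveD//; apply: diff_derivable; [exact: fd|exact: gd].
Qed.

Lemma is_CkM (R : realType) (V : normedModType R) (k : nat) (U : set V)
    (f g : V -> R) : open U ->
  is_Ck k U f -> is_Ck k U g -> is_Ck k U (fun p => f p * g p).
Proof.
move=> oU; elim: k f g => [|k IH] f g.
  by move=> fc gc p Up; apply: cvgM; [exact: fc|exact: gc].
move=> fC gC; have [[fd fD] [gd gD]] := (fC, gC); split.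
  by move=> p Up; apply: differentiableM; [exact: fd|exact: gd].
move=> v.
have fgD := is_CkD oU (IH _ _ (is_Ck_leS fC) (gD v)) (IH _ _ (is_Ck_leS gC) (fD v)).
apply: (is_Ck_ext oU _ fgD) => p Up.
rewrite (@deriveM _ _ f g)//; apply: diff_derivable; [exact: fd|exact: gd].
Qed.

(** The derivative of the inverse is a product in which the inverse itself
    occurs, so the order of smoothness can be raised one step at a time. *)
Lemma is_CkV (R : realType) (V : normedModType R) (k : nat) (U : set V)
    (f : V -> R) : open U -> (forall p, U p -> f p != 0) ->
  is_Ck k U f -> is_Ck k U (fun p => (f p)^-1).
Proof.
move=> oU f0; elim: k => [|k IH].
  by move=> fc p Up; apply: cvgV; [exact: f0|exact: fc].
move=> fC; have [fd fD] := fC; split.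
  by move=> p Up; apply: differentiableV; [exact: fd|exact: f0].
move=> v; have fVC := IH (is_Ck_leS fC).
have fVD := is_CkM oU (is_CkM oU (is_Ck_cst k U (-1 : R)) (is_CkM oU fVC fVC))
  (fD v).
apply: (is_Ck_ext oU _ fVD) => p Up.
rewrite deriveV ?f0//; last exact/diff_derivable/fd.
by rewrite mulN1r expr2 invfM.
Qed.

Lemma is_CkZl (R : realType) (V W : normedModType R) (k : nat) (U : set V)
    (f : V -> R) (w : W) : open U ->
  is_Ck k U f -> is_Ck k U (fun p => f p *: w).
Proof.
move=> oU; elim: k f => [|k IH] f.
  by move=> fc p Up; apply: cvgZr_tmp; exact: fc.
move=> [fd fD]; split.
  by move=> p Up; apply: differentiableZl; exact: fd.
move=> v; apply: (is_Ck_ext oU _ (IH _ (fD v))) => p Up.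
have fdp := fd p Up.
by rewrite !deriveE ?diffZl//; exact: differentiableZl.
Qed.

Lemma derive_coord (R : realType) (m n : nat) (p v : 'M[R]_(m, n)) i j :
  'D_v (fun q : 'M[R]_(m, n) => q i j : R) p = v i j.
Proof.
have /derive_mx : derivable (@idfun 'M[R]_(m, n)) p v by exact: derivable_id.
by rewrite derive_id => /matrixP/(_ i j); rewrite mxE.
Qed.

Lemma is_Ck_coord (R : realType) (m n : nat) (k : nat) (U : set 'M[R]_(m, n))
    i j :
  is_Ck k U (fun p : 'M[R]_(m, n) => p i j : R).
Proof.
case: k => [p _|k]; first exact/differentiable_continuous/differentiable_coord.
split=> [p _|v]; first exact: differentiable_coord.
have -> : (fun p => 'D_v (fun q : 'M[R]_(m, n) => q i j : R) p) = fun=> v i j.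
  by apply/funext => p; rewrite derive_coord.
exact: is_Ck_cst.
Qed.

Lemma is_Ck_sum (R : realType) (V W : normedModType R) (k : nat) (U : set V)
    (I : Type) (r : seq I) (f : I -> V -> W) : open U ->
  (forall i, is_Ck k U (f i)) -> is_Ck k U (fun p => \sum_(i <- r) f i p).
Proof.
move=> oU fC; elim: r => [|i r IH].
  apply: (is_Ck_ext oU _ (is_Ck_cst k U 0)) => p _.
  by rewrite big_nil.
apply: (is_Ck_ext oU _ (is_CkD oU (fC i) IH)) => p _.
by rewrite big_cons.
Qed.

Section smooth_theory.
Variables (R : realType) (V : normedModType R) (U : set V).
Hypothesis oU : open U.

Lemma smooth_cst (W : normedModType R) (w : W) : smooth U (fun=> w).
Proof. by move=> k; exact: is_Ck_cst. Qed.

Lemma smoothD (W : normedModType R) (f g : V -> W) :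
  smooth U f -> smooth U g -> smooth U (fun p => f p + g p).
Proof. by move=> fs gs k; exact: is_CkD. Qed.

Lemma smooth_sum (W : normedModType R) (I : Type) (r : seq I) (f : I -> V -> W) :
  (forall i, smooth U (f i)) -> smooth U (fun p => \sum_(i <- r) f i p).
Proof. by move=> fs k; apply: is_Ck_sum => // i; exact: fs. Qed.

Lemma smoothM (f g : V -> R) :
  smooth U f -> smooth U g -> smooth U (fun p => f p * g p).
Proof. by move=> fs gs k; exact: is_CkM. Qed.

Lemma smoothN (f : V -> R) : smooth U f -> smooth U (fun p => - f p).
Proof.
move=> fs k; have := is_CkM oU (is_Ck_cst k U (-1 : R)) (fs k).
by apply: is_Ck_ext => // p _; rewrite mulN1r.
Qed.

Lemma smoothV (f : V -> R) : (forall p, U p -> f p != 0) ->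
  smooth U f -> smooth U (fun p => (f p)^-1).
Proof. by move=> f0 fs k; exact: is_CkV. Qed.

Lemma smooth_mx (m n : nat) (f : V -> 'M[R]_(m, n)) :
  (forall i j, smooth U (fun p => f p i j)) -> smooth U f.
Proof.
move=> fs k.
have fC : is_Ck k U (fun p => \sum_(i < m) \sum_(j < n) f p i j *: delta_mx i j).
  by do 2![apply: is_Ck_sum => // ?]; apply: is_CkZl => //; exact: fs.
by apply: (is_Ck_ext oU _ fC) => p _; rewrite -matrix_sum_delta.
Qed.

End smooth_theory.

Lemma smooth_coord (R : realType) (m n : nat) (U : set 'M[R]_(m, n)) i j :
  smooth U (fun p : 'M[R]_(m, n) => p i j : R).
Proof. by move=> k; exact: is_Ck_coord. Qed.

Lemma smooth_differentiable (R : realType) (V W : normedModType R) (U : set V)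
    (f : V -> W) (p : V) :
  smooth U f -> U p -> differentiable f p.
Proof. by move=> fs; have [fd _] := fs 1; exact: fd. Qed.

Lemma open_neq0 (R : realType) (V : normedModType R) (f : V -> R) :
  smooth setT f -> open [set p | f p != 0].
Proof.
move=> fs; apply: (@open_comp _ _ f [set x | x != 0]); last exact: open_neq.
by move=> p _; exact: (fs 0).
Qed.

Lemma smooth_scale (R : realType) (V : normedModType R) (U : set V) (c : R)
    (f : V -> R) :
  open U -> smooth U f -> smooth U (fun p => c * f p).
Proof. by move=> oU fs; apply: smoothM => //; exact: smooth_cst. Qed.

Lemma is_deriveM_fun (R : realType) (V : normedModType R) (f g : V -> R) (p v : V)
    (df dg : R) :
  is_derive p v f df -> is_derive p v g dg ->
  is_derive p v (fun q => f q * g q) (f p * dg + g p * df).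
Proof. by move=> fd gd; exact: is_deriveM. Qed.

Lemma is_deriveD_fun (R : realType) (V : normedModType R) (f g : V -> R) (p v : V)
    (df dg : R) :
  is_derive p v f df -> is_derive p v g dg ->
  is_derive p v (fun q => f q + g q) (df + dg).
Proof. by move=> fd gd; exact: is_deriveD. Qed.

Lemma is_deriveN_fun (R : realType) (V : normedModType R) (f : V -> R) (p v : V)
    (df : R) :
  is_derive p v f df -> is_derive p v (fun q => - f q) (- df).
Proof. by move=> fd; exact: is_deriveN. Qed.

Lemma is_deriveV_fun (R : realType) (V : normedModType R) (f : V -> R) (p v : V)
    (df : R) : f p != 0 ->
  is_derive p v f df -> is_derive p v (fun q => (f q)^-1) (- (f p) ^- 2 * df).
Proof.
by move=> f0 [fd <-]; split; [exact: derivableV|exact: deriveV].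
Qed.

Lemma is_derive_scale (R : realType) (V : normedModType R) (c : R) (f : V -> R)
    (p v : V) (df : R) :
  is_derive p v f df -> is_derive p v (fun q => c * f q) (c * df).
Proof. by move=> fd; exact: is_deriveZ. Qed.

(** * Two-by-two blocks and coordinates on R^4 *)

(** Case analysis of an index of R^4 that keeps the split into x- and
    z-coordinates. *)
Variant idx4_spec : 'I_4 -> Type :=
| Idx4X A : idx4_spec (x_idx A)
| Idx4Z A : idx4_spec (z_idx A).

Lemma idx4P i : idx4_spec i.
Proof. by case: (@split_ordP 2 2 i) => A ->; constructor. Qed.

Variant idx2_spec : 'I_2 -> Type := Idx20 : idx2_spec 0 | Idx21 : idx2_spec 1.

Lemma idx2P A : idx2_spec A.
Proof.
case: A => [[|[|//]] lt]; [rewrite (_ : Ordinal _ = 0)|rewrite (_ : Ordinal _ = 1)];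
  by [constructor|exact: val_inj].
Qed.

Lemma lift2_0 : lift ord0 ord0 = 1 :> 'I_2.
Proof. exact: val_inj. Qed.

Lemma sum2E (R : zmodType) (F : 'I_2 -> R) : \sum_i F i = F 0 + F 1.
Proof. by rewrite big_ord_recl big_ord1 lift2_0. Qed.

(** Fixing the sizes makes the type of a block matrix syntactically that of a
    matrix of size 4, so that the block identities apply by rewriting. *)
Definition blk (R : realType) (A B C D : 'M[R]_2) : 'M[R]_4 :=
  @block_mx R 2 2 2 2 A B C D.

Lemma blkE (R : realType) (A B C D : 'M[R]_2) i j :
  (blk A B C D (x_idx i) (x_idx j) = A i j) *
  (blk A B C D (x_idx i) (z_idx j) = B i j) *
  (blk A B C D (z_idx i) (x_idx j) = C i j) *
  (blk A B C D (z_idx i) (z_idx j) = D i j).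
Proof.
by do !split; [exact: (@block_mxEul R 2 2 2 2)|exact: (@block_mxEur R 2 2 2 2)|
  exact: (@block_mxEdl R 2 2 2 2)|exact: (@block_mxEdr R 2 2 2 2)].
Qed.

Lemma mul_blk (R : realType) (A B C D A' B' C' D' : 'M[R]_2) :
  blk A B C D *m blk A' B' C' D' =
  blk (A *m A' + B *m C') (A *m B' + B *m D')
      (C *m A' + D *m C') (C *m B' + D *m D').
Proof. exact: (@mulmx_block R 2 2 2 2 2 2). Qed.

Lemma tr_blk (R : realType) (A B C D : 'M[R]_2) :
  (blk A B C D)^T = blk A^T C^T B^T D^T.
Proof. exact: (@tr_block_mx R 2 2 2 2). Qed.

Lemma blk_scalar (R : realType) (a : R) : blk a%:M 0 0 a%:M = a%:M.
Proof. exact/esym/(@scalar_mx_block R 2 2). Qed.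

Lemma scale_blk (R : realType) (a : R) (A B C D : 'M[R]_2) :
  a *: blk A B C D = blk (a *: A) (a *: B) (a *: C) (a *: D).
Proof. exact: (@scale_block_mx R 2 2 2 2). Qed.

Lemma add_blk (R : realType) (A B C D A' B' C' D' : 'M[R]_2) :
  blk A B C D + blk A' B' C' D' = blk (A + A') (B + B') (C + C') (D + D').
Proof. exact: (@add_block_mx R 2 2 2 2). Qed.

Lemma cv4P (R : realType) (v w : 'cV[R]_4) :
  (forall A, xc v A = xc w A) -> (forall A, zc v A = zc w A) -> v = w.
Proof.
move=> vwx vwz; apply/matrixP => i k; rewrite (ord1 k).
by case/idx4P: i => A; [exact: vwx|exact: vwz].
Qed.

Lemma mul_blk_col (R : realType) (A B C D : 'M[R]_2) (v : 'cV[R]_4) i :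
  (xc (blk A B C D *m v) i = \sum_j A i j * xc v j + \sum_j B i j * zc v j) *
  (zc (blk A B C D *m v) i = \sum_j C i j * xc v j + \sum_j D i j * zc v j).
Proof.
have E (F : 'I_4 -> R) : \sum_k F k = \sum_j F (x_idx j) + \sum_j F (z_idx j).
  exact: (@big_split_ord _ _ _ 2 2).
by split; rewrite [LHS]mxE E; congr (_ + _); apply: eq_bigr => k _; rewrite blkE.
Qed.

Lemma mul_i_coord (R : realType) (w : 'cV[R]_4) A :
  (xc (mul_i R *m w) A = - zc w A) * (zc (mul_i R *m w) A = xc w A).
Proof.
rewrite -[mul_i R]/(blk 0 (- 1%:M) 1%:M 0).
by split; rewrite mul_blk_col !sum2E !mxE; case/idx2P: A;
  rewrite /= ?mulr1n ?mulr0n; ring.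
Qed.

Lemma smooth_blk (R : realType) (U : set 'cV[R]_4) (A B C D : 'cV[R]_4 -> 'M[R]_2) :
  open U ->
  (forall i j, smooth U (fun p => A p i j)) ->
  (forall i j, smooth U (fun p => B p i j)) ->
  (forall i j, smooth U (fun p => C p i j)) ->
  (forall i j, smooth U (fun p => D p i j)) ->
  smooth U (fun p => blk (A p) (B p) (C p) (D p)).
Proof.
move=> oU sA sB sC sD; apply: smooth_mx => // i j.
case/idx4P: i => i; case/idx4P: j => j; under eq_fun do rewrite blkE.
- exact: sA.
- exact: sB.
- exact: sC.
- exact: sD.
Qed.

Definition col4 (R : realType) (a b c d : R) : 'cV[R]_4 :=
  \col_i [:: a; b; c; d]`_i.

Lemma col4E (R : realType) (a b c d : R) :
  (xc (col4 a b c d) 0 = a) * (xc (col4 a b c d) 1 = b) *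
  (zc (col4 a b c d) 0 = c) * (zc (col4 a b c d) 1 = d).
Proof. by rewrite /xc /zc !mxE. Qed.

Lemma smooth_col4 (R : realType) (U : set 'cV[R]_4)
    (f0 f1 f2 f3 : 'cV[R]_4 -> R) : open U ->
  smooth U f0 -> smooth U f1 -> smooth U f2 -> smooth U f3 ->
  smooth U (fun p => col4 (f0 p) (f1 p) (f2 p) (f3 p)).
Proof.
move=> oU s0 s1 s2 s3; apply: smooth_mx => // i j; rewrite (ord1 j) => {j}.
case/idx4P: i => A; case/idx2P: A.
- suff -> : (fun p => col4 (f0 p) (f1 p) (f2 p) (f3 p) (x_idx 0) 0) = f0 by [].
  by apply/funext => p; rewrite -/(xc _ _) col4E.
- suff -> : (fun p => col4 (f0 p) (f1 p) (f2 p) (f3 p) (x_idx 1) 0) = f1 by [].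
  by apply/funext => p; rewrite -/(xc _ _) col4E.
- suff -> : (fun p => col4 (f0 p) (f1 p) (f2 p) (f3 p) (z_idx 0) 0) = f2 by [].
  by apply/funext => p; rewrite -/(zc _ _) col4E.
- suff -> : (fun p => col4 (f0 p) (f1 p) (f2 p) (f3 p) (z_idx 1) 0) = f3 by [].
  by apply/funext => p; rewrite -/(zc _ _) col4E.
Qed.

Lemma smooth_xc (R : realType) (U : set 'cV[R]_4) A : smooth U (fun p => xc p A).
Proof. exact: smooth_coord. Qed.

Lemma smooth_zc (R : realType) (U : set 'cV[R]_4) A : smooth U (fun p => zc p A).
Proof. exact: smooth_coord. Qed.

Lemma is_derive_xc (R : realType) (p v : 'cV[R]_4) A :
  is_derive p v (fun q => xc q A) (xc v A).
Proof.
split; first exact/diff_derivable/differentiable_coord.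
exact: derive_coord.
Qed.

Lemma is_derive_zc (R : realType) (p v : 'cV[R]_4) A :
  is_derive p v (fun q => zc q A) (zc v A).
Proof.
split; first exact/diff_derivable/differentiable_coord.
exact: derive_coord.
Qed.

(** * The adapted coframe and the action of traceless matrices *)

Definition zcol (R : realType) (p : 'cV[R]_4) : 'cV[R]_2 := \col_A zc p A.
Definition zz (R : realType) (p : 'cV[R]_4) : 'M[R]_2 := zcol p *m (zcol p)^T.

(** The columns are the basis dual to the coframe (dx^A, e_A): the vector
    fields d/dx^A - z_A z_B d/dz_B, then d/dz_A. *)
Definition frame (R : realType) (p : 'cV[R]_4) : 'M[R]_4 :=
  blk 1%:M 0 (- zz p) 1%:M.
(** The rows are the one-forms dx^A and e_A = dz_A + z_A z_B dx^B. *)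
Definition coframe (R : realType) (p : 'cV[R]_4) : 'M[R]_4 :=
  blk 1%:M 0 (zz p) 1%:M.
Definition flat_metric (R : realType) : 'M[R]_4 :=
  blk 0 (2^-1)%:M (2^-1)%:M 0.

Lemma coframeK (R : realType) (p : 'cV[R]_4) : coframe p *m frame p = 1%:M.
Proof.
by rewrite mul_blk !(mul1mx, mulmx1, mul0mx, mulmx0) !(addr0, add0r) subrr
  blk_scalar.
Qed.

Lemma frameK (R : realType) (p : 'cV[R]_4) : frame p *m coframe p = 1%:M.
Proof. exact/mulmx1C/coframeK. Qed.

Lemma zzE (R : realType) (p : 'cV[R]_4) A B : zz p A B = zc p A * zc p B.
Proof. by rewrite mxE big_ord1 !mxE. Qed.

Lemma tr_zz (R : realType) (p : 'cV[R]_4) : (zz p)^T = zz p.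
Proof. by rewrite /zz trmx_mul trmxK. Qed.

Lemma smooth_zz (R : realType) (U : set 'cV[R]_4) A B : open U ->
  smooth U (fun p => zz p A B).
Proof.
by move=> oU; under eq_fun do rewrite zzE; apply: smoothM => //; exact: smooth_zc.
Qed.

Lemma sl3_gl2_metric_blk (R : realType) (p : 'cV[R]_4) :
  sl3_gl2_metric p = blk (zz p) (2^-1)%:M (2^-1)%:M 0.
Proof.
have tr_dx A : (dx R A)^T = delta_mx (x_idx A) 0 by rewrite trmx_delta.
have tr_dz A : (dz R A)^T = delta_mx (z_idx A) 0 by rewrite trmx_delta.
rewrite /sl3_gl2_metric /sym_prod !big_ord_recl !big_ord0 !addr0.
rewrite !(tr_dx, tr_dz) !mul_delta_mx.
apply/matrixP => i j.
case/idx4P: i => i; case/idx4P: j => j; rewrite blkE ?zzE !mxE;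
  by case/idx2P: i; case/idx2P: j; rewrite /= ?lift2_0; field.
Qed.

Lemma metric_coframe (R : realType) (p : 'cV[R]_4) :
  sl3_gl2_metric p = (coframe p)^T *m flat_metric R *m coframe p.
Proof.
rewrite sl3_gl2_metric_blk /coframe tr_blk !mul_blk tr_zz trmx0 trmx1.
rewrite !(mul1mx, mulmx1, mul0mx, mulmx0) !(addr0, add0r).
rewrite -scalemx1 -scalemxAl -scalemxAr mul1mx mulmx1 -scalerDl.
rewrite mul0mx addr0 (_ : 2^-1 + 2^-1 = 1) ?scale1r//; by field.
Qed.

Lemma smooth_metric (R : realType) : smooth [set: 'cV[R]_4] (@sl3_gl2_metric R).
Proof.
have oT := @openT 'cV[R]_4.
rewrite (funext (@sl3_gl2_metric_blk R)).
apply: smooth_blk => // A B; try exact: smooth_cst.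
exact: smooth_zz.
Qed.

(** The Lie algebra action of j on R^2 and its dual.  The transpose reverses
    products, and the minus sign compensates for this: t s i = -1, so the
    relation i s t = 1 holds on both summands. *)
Definition twist (R : realType) (j : 'M[R]_2) : 'M[R]_4 := blk j 0 0 (- j^T).

Definition lift_sl2 (R : realType) (j : 'M[R]_2) (p : 'cV[R]_4) : 'M[R]_4 :=
  frame p *m twist j *m coframe p.

Lemma lift_sl2_mul (R : realType) (i j : 'M[R]_2) (p : 'cV[R]_4) :
  lift_sl2 i p *m lift_sl2 j p = frame p *m (twist i *m twist j) *m coframe p.
Proof.
by rewrite /lift_sl2 -!mulmxA; congr (_ *m (_ *m _));
  rewrite 2!mulmxA coframeK mul1mx.
Qed.

Lemma twist_sqr (R : realType) (j : 'M[R]_2) (e : R) :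
  j *m j = e%:M -> twist j *m twist j = e%:M.
Proof.
move=> jj; rewrite mul_blk !(mul0mx, mulmx0) !(addr0, add0r) jj.
by rewrite mulNmx mulmxN opprK -trmx_mul jj tr_scalar_mx blk_scalar.
Qed.

Lemma lift_sl2_sqr (R : realType) (j : 'M[R]_2) (e : R) (p : 'cV[R]_4) :
  j *m j = e%:M -> lift_sl2 j p *m lift_sl2 j p = e%:M.
Proof.
move=> /twist_sqr jj; rewrite lift_sl2_mul jj.
by rewrite -scalemx1 -scalemxAr -scalemxAl mulmx1 frameK.
Qed.

(** The pairing of j v with -j^T w is the pairing of v with -(j^2)^T w. *)
Lemma flat_twist (R : realType) (j : 'M[R]_2) (e : R) : j *m j = e%:M ->
  (twist j)^T *m flat_metric R *m twist j = - e *: flat_metric R.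
Proof.
move=> jj; rewrite tr_blk !mul_blk [(- _)^T]raddfN/= trmxK trmx0.
rewrite !mul_mx_scalar !(mul0mx, mulmx0, scaler0) !(addr0, add0r).
rewrite mulmxN -!scalemxAl mulNmx -trmx_mul jj tr_scalar_mx -!scaleNr.
by rewrite !mul0mx scale_blk !scaler0 !scale_scalar_mx scalerN scale_scalar_mx
  !mulNr [e * _]mulrC raddfN.
Qed.

Lemma lift_sl2_metric (R : realType) (j : 'M[R]_2) (e : R) (p : 'cV[R]_4) :
  j *m j = e%:M ->
  (lift_sl2 j p)^T *m sl3_gl2_metric p *m lift_sl2 j p = - e *: sl3_gl2_metric p.
Proof.
move=> /flat_twist jG; rewrite metric_coframe.
transitivity ((coframe p)^T *m ((twist j)^T *m flat_metric R *m twist j) *m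
  coframe p); last by rewrite jG -scalemxAr -scalemxAl.
rewrite /lift_sl2 !trmx_mul -!mulmxA; congr (_ *m (_ *m _)).
rewrite [_ *m (frame p *m _)]mulmxA coframeK mul1mx.
by rewrite mulmxA -trmx_mul coframeK trmx1 mul1mx.
Qed.

Lemma pairing_lift_sl2 (R : realType) (j : 'M[R]_2) (e : R) (p v : 'cV[R]_4) :
  j *m j = e%:M ->
  pairing (sl3_gl2_metric p) (lift_sl2 j p *m v) (lift_sl2 j p *m v) =
  - e * pairing (sl3_gl2_metric p) v v.
Proof.
move=> /(lift_sl2_metric p) jG; rewrite /pairing.
transitivity
  ((v^T *m ((lift_sl2 j p)^T *m sl3_gl2_metric p *m lift_sl2 j p) *m v) 0 0).
  by rewrite trmx_mul !mulmxA.
by rewrite jG -scalemxAr -scalemxAl mxE.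
Qed.

(** A pairing of R^2 with its dual is the difference of two sums of squares in
    the sum and difference variables. *)
Lemma metric_neutral (R : realType) (p : 'cV[R]_4) :
  exists2 B : 'M[R]_4, B \in unitmx &
    B^T *m sl3_gl2_metric p *m B = @block_mx R 2 2 2 2 1%:M 0 0 (- 1%:M).
Proof.
(* The columns of N are the sums and differences of dual basis vectors. *)
pose N : 'M[R]_4 := blk 1%:M 1%:M 1%:M (- 1%:M).
have NN : N *m ((2^-1 : R) *: N) = 1%:M.
  rewrite -scalemxAr mul_blk !mulNmx !mulmxN !mulmx1 opprK subrr scale_blk !scaler0.
  rewrite -!raddfD/= !scale_scalar_mx (_ : 2^-1 * _ = 1) ?blk_scalar//.
  by field.
exists (frame p *m N).
  have: (frame p *m N) *m (2^-1 *: N *m coframe p) = 1%:M.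
    by rewrite mulmxA -(mulmxA (frame p)) NN mulmx1 frameK.
  by case/mulmx1_unit.
transitivity (N^T *m flat_metric R *m N).
  rewrite metric_coframe trmx_mul -!mulmxA; congr (_ *m _).
  rewrite [coframe p *m _]mulmxA coframeK mul1mx.
  by rewrite mulmxA -trmx_mul coframeK trmx1 mul1mx.
rewrite tr_blk !mul_blk [(- _)^T]raddfN/= trmx1.
rewrite !(mul0mx, mulmx0, mul1mx, mulmx1, addr0, add0r, mulNmx, mulmxN).
rewrite -[block_mx _ _ _ _]/(blk _ _ _ _) subrr addNr -opprD -!raddfD/=.
by rewrite (_ : 2^-1 + 2^-1 = 1) //; field.
Qed.

(** The traceless matrix ai + bs + ct. *)
Definition jmat (R : realType) (a b c : R) : 'M[R]_2 :=
  \matrix_(i, j) if i == 0 then if j == 0 then b else c - a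
                 else if j == 0 then a + c else - b.

Lemma jmat_sqr (R : realType) (a b c : R) :
  jmat a b c *m jmat a b c = (b ^+ 2 + c ^+ 2 - a ^+ 2)%:M.
Proof.
apply/matrixP => i j; rewrite !mxE big_ord_recl big_ord1 !mxE.
by case/idx2P: i; case/idx2P: j; rewrite /= ?mulr0n ?mulr1n; ring.
Qed.

Lemma lift_jmat_linear (R : realType) (a b c : R) (p : 'cV[R]_4) :
  a *: lift_sl2 (jmat 1 0 0) p + b *: lift_sl2 (jmat 0 1 0) p +
  c *: lift_sl2 (jmat 0 0 1) p = lift_sl2 (jmat a b c) p.
Proof.
rewrite /lift_sl2 -!mulmxA !(scalemxAr _ (frame p)) !(scalemxAl _ (twist _)).
rewrite -!mulmxDr -!mulmxDl; congr (_ *m (_ *m _)).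
rewrite !scale_blk !add_blk !scaler0 !addr0;
  congr blk; apply/matrixP => i j; rewrite !mxE;
  by case/idx2P: i; case/idx2P: j; rewrite /=; ring.
Qed.

Lemma jmat_IST (R : realType) (p : 'cV[R]_4) :
  lift_sl2 (jmat 1 0 0) p *m lift_sl2 (jmat 0 1 0) p *m lift_sl2 (jmat 0 0 1) p =
  1%:M.
Proof.
have IS : twist (jmat 1 0 0) *m twist (jmat 0 1 0) = twist (jmat (0 : R) 0 1).
  rewrite mul_blk !(mul0mx, mulmx0, addr0, add0r); congr blk;
  apply/matrixP => i j; rewrite !mxE big_ord_recl big_ord1 !mxE;
  by case/idx2P: i; case/idx2P: j; rewrite /=; ring.
rewrite lift_sl2_mul IS (@lift_sl2_sqr _ _ 1)// jmat_sqr.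
by congr (_%:M); ring.
Qed.

Lemma lift_sl2_blk (R : realType) (j : 'M[R]_2) (p : 'cV[R]_4) :
  lift_sl2 j p = blk j 0 (- (zz p *m j + j^T *m zz p)) (- j^T).
Proof.
rewrite /lift_sl2 !mul_blk !(mul0mx, mulmx0, mul1mx, mulmx1, addr0, add0r).
by rewrite !mulNmx opprD.
Qed.

Lemma smooth_lift_sl2 (R : realType) (j : 'M[R]_2) :
  smooth [set: 'cV[R]_4] (lift_sl2 j).
Proof.
have oT := @openT 'cV[R]_4.
rewrite (funext (lift_sl2_blk j)).
apply: smooth_blk => // A B; try exact: smooth_cst.
have entryE p : (- (zz p *m j + j^T *m zz p)) A B =
    - (\sum_k zz p A k * j k B + \sum_k j k A * zz p k B).
  by rewrite 2!mxE [X in _ + X]mxE mxE; under [X in _ + X]eq_bigr do rewrite mxE.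
under eq_fun do rewrite entryE.
apply: smoothN => //; apply: smoothD => //; apply: smooth_sum => // k;
  by apply: smoothM => //; first [exact: smooth_zz|exact: smooth_cst].
Qed.

(** The new x-part w is used to express the new z-part: in the coordinate frame
    the z-components of a vector are its e_A-components minus z_A (z_B x^B). *)
Lemma lift_jmat_coord (R : realType) (a b c : R) (p v : 'cV[R]_4)
    (w := lift_sl2 (jmat a b c) p *m v) (x0 := xc v 0) (x1 := xc v 1)
    (z0 := zc p 0) (z1 := zc p 1) (e := z0 * x0 + z1 * x1) :
  [/\ xc w 0 = b * x0 + (c - a) * x1,
      xc w 1 = (a + c) * x0 - b * x1,
      zc w 0 = - z0 * (z0 * xc w 0 + z1 * xc w 1)
               - b * (zc v 0 + z0 * e) - (a + c) * (zc v 1 + z1 * e) &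
      zc w 1 = - z1 * (z0 * xc w 0 + z1 * xc w 1)
               - (c - a) * (zc v 0 + z0 * e) + b * (zc v 1 + z1 * e)].
Proof.
rewrite {}/w lift_sl2_blk; move: (zz p) (zzE p) => Z ZE.
split; rewrite !mul_blk_col !sum2E !mxE ?sum2E ?mxE /= ?ZE
   -/x0 -/x1 -/z0 -/z1 /e; ring.
Qed.

(** * A Moebius involution of the complex line *)

(** With zeta = r + i s, this is the squared modulus of al zeta - 1; the next two
    functions are the real and imaginary parts of zeta / (al zeta - 1). *)
Definition mob_den (R : realType) (al r s : R) : R :=
  (al * r - 1) * (al * r - 1) + al * s * (al * s).
Definition mob_re (R : realType) (al r s : R) : R :=
  (al * (r * r + s * s) - r) * (mob_den al r s)^-1.
Definition mob_im (R : realType) (al r s : R) : R :=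
  - s * (mob_den al r s)^-1.

(** If w = zeta / (al zeta - 1), then al w - 1 = 1 / (al zeta - 1). *)
Lemma mob_denK (R : realType) (al r s : R) : mob_den al r s != 0 ->
  mob_den al (mob_re al r s) (mob_im al r s) = (mob_den al r s)^-1.
Proof.
by rewrite /mob_re /mob_im /mob_den => D0; field.
Qed.

Lemma mob_reK (R : realType) (al r s : R) : mob_den al r s != 0 ->
  mob_re al (mob_re al r s) (mob_im al r s) = r.
Proof.
move=> D0; rewrite {1}/mob_re mob_denK// invrK.
by move: D0; rewrite /mob_re /mob_im /mob_den => D0; field.
Qed.

Lemma mob_imK (R : realType) (al r s : R) : mob_den al r s != 0 ->
  mob_im al (mob_re al r s) (mob_im al r s) = s.
Proof.
move=> D0; rewrite {1}/mob_im mob_denK// invrK /mob_im.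
by rewrite !mulNr opprK divfK.
Qed.

Section mob_smooth.
Variables (R : realType) (V : normedModType R) (U : set V).
Hypothesis oU : open U.
Variables al r s : V -> R.
Hypotheses (als : smooth U al) (rs : smooth U r) (ss : smooth U s).

Lemma smooth_mob_den : smooth U (fun p => mob_den (al p) (r p) (s p)).
Proof.
have ars : smooth U (fun p => al p * r p - 1).
  by apply: smoothD => //; [exact: smoothM|exact: smooth_cst].
have ass : smooth U (fun p => al p * s p) by exact: smoothM.
by apply: smoothD => //; exact: smoothM.
Qed.

Hypothesis D0 : forall p, U p -> mob_den (al p) (r p) (s p) != 0.

Lemma smooth_mob_re : smooth U (fun p => mob_re (al p) (r p) (s p)).
Proof.
apply: smoothM => //; last by apply: smoothV => //; exact: smooth_mob_den.
apply: smoothD => //; last exact: smoothN.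
by apply: smoothM => //; apply: smoothD => //; exact: smoothM.
Qed.

Lemma smooth_mob_im : smooth U (fun p => mob_im (al p) (r p) (s p)).
Proof.
apply: smoothM => //; first exact: smoothN.
by apply: smoothV => //; exact: smooth_mob_den.
Qed.

End mob_smooth.

Section mob_derive.
Variables (R : realType) (V : normedModType R) (al r s : V -> R) (p v : V).
Variables dal dr ds : R.
Hypotheses (ald : is_derive p v al dal) (rd : is_derive p v r dr)
  (sd : is_derive p v s ds).
Let a := al p. Let rho := r p. Let sig := s p.
Let D := mob_den a rho sig.
Hypothesis D0 : D != 0.
Let A := dr + (rho * rho - sig * sig) * dal.
Let B := ds + 2 * rho * sig * dal.
Let X := (a * rho - 1) ^+ 2 - (a * sig) ^+ 2.
Let Y := 2 * (a * rho - 1) * (a * sig).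

Let dV : is_derive p v (fun q => (mob_den (al q) (r q) (s q))^-1)
  (- D ^- 2 * (2 * (a * rho - 1) * (a * dr + rho * dal)
               + 2 * (a * sig) * (a * ds + sig * dal))).
Proof.
have d1 := is_derive_cst (-1 : R) p v.
have dc := is_deriveD_fun (is_deriveM_fun ald rd) d1.
have dt := is_deriveM_fun ald sd.
have dD := is_deriveD_fun (is_deriveM_fun dc dc) (is_deriveM_fun dt dt).
apply: is_derive_eq
  (is_deriveV_fun (f := fun q => mob_den (al q) (r q) (s q)) D0 dD) _.
by rewrite /cst -/a -/rho -/sig /D; ring.
Qed.

(** In complex notation, the differential of zeta / (al zeta - 1) is
    - (dzeta + zeta^2 dal) / (al zeta - 1)^2.  Here A + iB is the numerator and
    X + iY the square in the denominator, whose squared modulus is D^2. *)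
Lemma derive_mob_re :
  'D_v (fun q => mob_re (al q) (r q) (s q)) p = - (X * A + Y * B) / D ^+ 2.
Proof.
have h := is_deriveM_fun (is_deriveD_fun (is_deriveM_fun ald
  (is_deriveD_fun (is_deriveM_fun rd rd) (is_deriveM_fun sd sd)))
  (is_deriveN_fun rd)) dV.
rewrite [LHS](@derive_val _ _ _ _ _ _ _ h) -/a -/rho -/sig /X /Y /A /B /D /cst.
by move: D0; rewrite /D /mob_den => D0'; field.
Qed.

Lemma derive_mob_im :
  'D_v (fun q => mob_im (al q) (r q) (s q)) p = - (X * B - Y * A) / D ^+ 2.
Proof.
have h := is_deriveM_fun (is_deriveN_fun sd) dV.
rewrite [LHS](@derive_val _ _ _ _ _ _ _ h) -/a -/rho -/sig /X /Y /A /B /D /cst.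
by move: D0; rewrite /D /mob_den => D0'; field.
Qed.

End mob_derive.

(** * Holomorphic charts *)

Section chart.
Variables (R : realType) (m k e : R).
Hypothesis k0 : k != 0.

(** With tau = m + i k, these are the three arguments of the involution:
    x^0 - e and the two parts of zeta = z_0 + tau z_1. *)
Definition chart_al (p : 'cV[R]_4) : R := xc p 0 - e.
Definition chart_re (p : 'cV[R]_4) : R := zc p 0 + m * zc p 1.
Definition chart_im (p : 'cV[R]_4) : R := k * zc p 1.

Definition chart_dom : set 'cV[R]_4 :=
  [set p | mob_den (chart_al p) (chart_re p) (chart_im p) != 0].

(** The complex functions u = x^1 - tau x^0 and v = zeta / ((x^0 - e) zeta - 1),
    in the order (Re u, Re v, Im u, Im v). *)
Definition chart (p : 'cV[R]_4) : 'cV[R]_4 :=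
  col4 (xc p 1 - m * xc p 0) (mob_re (chart_al p) (chart_re p) (chart_im p))
       (- k * xc p 0) (mob_im (chart_al p) (chart_re p) (chart_im p)).

(** Since Im u = - k x^0, this recovers x^0 - e from the chart. *)
Definition inv_al (y : 'cV[R]_4) : R := - k^-1 * zc y 0 - e.

Definition chart_cod : set 'cV[R]_4 :=
  [set y | mob_den (inv_al y) (xc y 1) (zc y 1) != 0].

Definition chart_inv (y : 'cV[R]_4) : 'cV[R]_4 :=
  let s := k^-1 * mob_im (inv_al y) (xc y 1) (zc y 1) in
  col4 (- k^-1 * zc y 0) (xc y 0 - m * (k^-1 * zc y 0))
       (mob_re (inv_al y) (xc y 1) (zc y 1) - m * s) s.

Lemma inv_al_chart p : inv_al (chart p) = chart_al p.
Proof. by rewrite /inv_al /chart col4E mulrA mulrNN mulVf// mul1r. Qed.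

Lemma chart_coord_inv (y : 'cV[R]_4) :
  [/\ chart_al (chart_inv y) = inv_al y,
      chart_re (chart_inv y) = mob_re (inv_al y) (xc y 1) (zc y 1) &
      chart_im (chart_inv y) = mob_im (inv_al y) (xc y 1) (zc y 1)].
Proof.
rewrite /chart_al /chart_re /chart_im /chart_inv !col4E; split=> //.
  by rewrite subrK.
by rewrite mulrA divff// mul1r.
Qed.

Lemma chartK p : chart_dom p -> chart_inv (chart p) = p.
Proof.
move=> D0; rewrite /chart_inv inv_al_chart.
rewrite [chart p]/chart !col4E mob_reK// mob_imK//.
apply: cv4P => A; case/idx2P: A; rewrite !col4E /chart_re /chart_im; by field.
Qed.

Lemma chart_invK y : chart_cod y -> chart (chart_inv y) = y.
Proof.
move=> D0; have [alE rE sE] := chart_coord_inv y.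
rewrite /chart alE rE sE mob_reK// mob_imK// /chart_inv.
by apply: cv4P => A; case/idx2P: A; rewrite !col4E //; field.
Qed.

(** The involution exchanges the two non-vanishing conditions, so the image of
    the chart is again the open set where a continuous function is non-zero. *)
Lemma chart_image : chart @` chart_dom = chart_cod.
Proof.
apply/seteqP; split=> [_ [p D0 <-]|y D0].
  by rewrite /chart_cod /= inv_al_chart /chart !col4E mob_denK// invr_eq0.
exists (chart_inv y); last exact: chart_invK.
have [alE rE sE] := chart_coord_inv y.
by rewrite /chart_dom /= alE rE sE mob_denK// invr_eq0.
Qed.

Section smoothness.
Variable U : set 'cV[R]_4.
Hypothesis oU : open U.

Lemma smooth_chart_al : smooth U chart_al.
Proof. by apply: smoothD => //; [exact: smooth_xc|exact: smooth_cst]. Qed.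

Lemma smooth_chart_re : smooth U chart_re.
Proof.
by apply: smoothD => //; [|apply: smooth_scale => //]; exact: smooth_zc.
Qed.

Lemma smooth_chart_im : smooth U chart_im.
Proof. by apply: smooth_scale => //; exact: smooth_zc. Qed.

Lemma smooth_inv_al : smooth U inv_al.
Proof.
apply: smoothD => //; last exact: smooth_cst.
by apply: smooth_scale => //; exact: smooth_zc.
Qed.

End smoothness.

Lemma open_chart_dom : open chart_dom.
Proof.
apply: open_neq0; apply: smooth_mob_den; try exact: openT.
- exact/smooth_chart_al/openT.
- exact/smooth_chart_re/openT.
- exact/smooth_chart_im/openT.
Qed.

Lemma open_chart_cod : open chart_cod.
Proof.
apply: open_neq0; apply: smooth_mob_den; try exact: openT.
- exact/smooth_inv_al/openT.
- exact/smooth_xc.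
- exact/smooth_zc.
Qed.

Lemma smooth_chart : smooth chart_dom chart.
Proof.
have oD := open_chart_dom.
have sal := smooth_chart_al oD; have sre := smooth_chart_re oD.
have sim := smooth_chart_im oD; have sx := @smooth_xc R chart_dom.
apply: smooth_col4 => //.
- apply: smoothD => //; apply: smoothN => //; exact: smooth_scale.
- exact: smooth_mob_re.
- exact: smooth_scale.
- exact: smooth_mob_im.
Qed.

Lemma smooth_chart_inv : smooth chart_cod chart_inv.
Proof.
have oD := open_chart_cod.
have sal := smooth_inv_al oD.
have sx := @smooth_xc R chart_cod; have sz := @smooth_zc R chart_cod.
have sre := smooth_mob_re oD sal (sx 1) (sz 1) (fun p Dp => Dp).
have sim := smooth_mob_im oD sal (sx 1) (sz 1) (fun p Dp => Dp).
apply: smooth_col4 => //.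
- exact: smooth_scale.
- by apply: smoothD => //; apply: smoothN => //; do 2!apply: smooth_scale => //.
- by apply: smoothD => //; apply: smoothN => //; do 2!apply: smooth_scale => //.
- exact: smooth_scale.
Qed.

Lemma is_derive_chart_al (p v : 'cV[R]_4) : is_derive p v chart_al (xc v 0).
Proof.
apply: is_derive_eq
  (is_deriveD_fun (is_derive_xc p v 0) (is_derive_cst (- e) p v)) _.
by rewrite addr0.
Qed.

Lemma is_derive_chart_re (p v : 'cV[R]_4) : is_derive p v chart_re (chart_re v).
Proof.
exact: is_deriveD_fun (is_derive_zc p v 0) (is_derive_scale m (is_derive_zc p v 1)).
Qed.

Lemma is_derive_chart_im (p v : 'cV[R]_4) : is_derive p v chart_im (chart_im v).
Proof. by have h := is_derive_scale k (is_derive_zc p v 1). Qed.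

Lemma derive_chart_comp (p v : 'cV[R]_4) : chart_dom p ->
  let al := chart_al p in let r := chart_re p in let s := chart_im p in
  let D := mob_den al r s in
  let X := (al * r - 1) ^+ 2 - (al * s) ^+ 2 in
  let Y := 2 * (al * r - 1) * (al * s) in
  let A := chart_re v + (r * r - s * s) * xc v 0 in
  let B := chart_im v + 2 * r * s * xc v 0 in
  'D_v chart p = col4 (xc v 1 - m * xc v 0) (- (X * A + Y * B) / D ^+ 2)
                      (- k * xc v 0) (- (X * B - Y * A) / D ^+ 2).
Proof.
move=> D0 al r s D X Y A B.
have /derive_mx -> : derivable chart p v.
  exact/diff_derivable/(smooth_differentiable smooth_chart).
have dal := is_derive_chart_al p v; have dr := is_derive_chart_re p v.
have ds := is_derive_chart_im p v.
apply: cv4P => C; case/idx2P: C; rewrite !col4E [LHS]mxE.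
- have h := is_deriveD_fun (is_derive_xc p v 1)
    (is_deriveN_fun (is_derive_scale m (is_derive_xc p v 0))).
  rewrite -(@derive_val _ _ _ _ _ _ _ h); congr ('D_v _ p).
  by apply/funext => q; rewrite -/(xc _ _) /chart col4E.
- rewrite -(derive_mob_re dal dr ds D0); congr ('D_v _ p).
  by apply/funext => q; rewrite -/(xc _ _) /chart col4E.
- rewrite -(@derive_val _ _ _ _ _ _ _ (is_derive_scale (- k) (is_derive_xc p v 0))).
  congr ('D_v _ p).
  by apply/funext => q; rewrite -/(zc _ _) /chart col4E.
- rewrite -(derive_mob_im dal dr ds D0); congr ('D_v _ p).
  by apply/funext => q; rewrite -/(zc _ _) /chart col4E.
Qed.

End chart.

(** By the formula for the differential of the chart, the Cauchy-Riemann
    equations for v reduce to those for A + iB = dzeta + zeta^2 dx^0, which is a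
    combination of the forms e_0 + tau e_1 and du of type (1,0). *)
Lemma chart_holomorphic (R : realType) (a b c e : R) :
  a ^+ 2 - b ^+ 2 - c ^+ 2 = 1 -> a - c != 0 ->
  let m := b / (a - c) in let k := (a - c)^-1 in
  holomorphic_chart (lift_sl2 (jmat a b c)) (chart_dom m k e) (chart m k e).
Proof.
move=> abc h0 m k; have k0 : k != 0 by rewrite invr_eq0.
split.
- exact: open_chart_dom.
- by rewrite chart_image//; exact: open_chart_cod.
- exact: smooth_chart.
- exists (chart_inv m k e); rewrite chart_image//; split.
    exact: smooth_chart_inv.
  by move=> q; exact: chartK.
move=> q D0 v; rewrite !derive_chart_comp//.
have [w0 w1 y0 y1] := lift_jmat_coord a b c q v.
set w := lift_sl2 _ q *m v in w0 w1 y0 y1 *; clearbody w.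
(* The equation of the hyperboloid, solved for the remaining entry of j. *)
have ac : a + c = (1 + b ^+ 2) / (a - c).
  by apply: (mulIf h0); rewrite divfK// -abc; ring.
(* Cauchy-Riemann equations for dzeta + zeta^2 dx^0 *)
have wA : chart_re m w +
    (chart_re m q * chart_re m q - chart_im k q * chart_im k q) * xc w 0 =
  - (chart_im k v + 2 * chart_re m q * chart_im k q * xc v 0).
  rewrite /chart_re /chart_im y0 y1 w0 w1 ac /m /k; by field.
have wB : chart_im k w + 2 * chart_re m q * chart_im k q * xc w 0 =
  chart_re m v +
    (chart_re m q * chart_re m q - chart_im k q * chart_im k q) * xc v 0.
  rewrite /chart_re /chart_im y1 w0 w1 ac /m /k; by field.
rewrite wA wB; apply: cv4P => A; rewrite !mul_i_coord;
  case/idx2P: A; rewrite !col4E; last by ring.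
- by rewrite w0 w1 ac /m /k; field.
- by ring.
- by rewrite w0 /k /m; field.
Qed.

(** On the hyperboloid a differs from c, since a^2 - c^2 = 1 + b^2, so tau is
    well defined.  Taking e to be x^0 at the given point makes the denominator
    (x^0 - e) zeta - 1 of v equal to -1 there. *)
Lemma lift_jmat_integrable (R : realType) (a b c : R) :
  a ^+ 2 - b ^+ 2 - c ^+ 2 = 1 ->
  integrable_complex_structure [set: 'cV[R]_4] (lift_sl2 (jmat a b c)).
Proof.
move=> abc; split; first exact: smooth_lift_sl2.
  have jj : jmat a b c *m jmat a b c = (-1)%:M.
    by rewrite jmat_sqr; congr (_%:M); rewrite -abc; ring.
  by move=> p _; rewrite (lift_sl2_sqr p jj) raddfN.
have h0 : a - c != 0.
  apply/eqP => /subr0_eq ac; have := sqr_ge0 b; move: abc; rewrite ac; lra.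
move=> p _.
exists (chart_dom (b / (a - c)) (a - c)^-1 (xc p 0)).
exists (chart (b / (a - c)) (a - c)^-1 (xc p 0)).
split=> //; last exact: chart_holomorphic.
by rewrite /chart_dom /= /chart_al subrr /mob_den !mul0r sub0r mulrNN
  mulr1 addr0 oner_eq0.
Qed.

Theorem proposition5p2 (R : realType) :
  pseudo_hyper_hermitian [set: 'cV[R]_4] (@sl3_gl2_metric R).
Proof.
split.
  split; first exact: smooth_metric.
    by move=> p _; rewrite sl3_gl2_metric_blk tr_blk tr_zz !tr_scalar_mx trmx0.
  by move=> p _; exact: metric_neutral.
exists (lift_sl2 (jmat 1 0 0)), (lift_sl2 (jmat 0 1 0)), (lift_sl2 (jmat 0 0 1)).
have II : jmat 1 0 0 *m jmat 1 0 0 = (-1 : R)%:M.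
  by rewrite jmat_sqr; congr (_%:M); ring.
have SS : jmat 0 1 0 *m jmat 0 1 0 = (1 : R)%:M.
  by rewrite jmat_sqr; congr (_%:M); ring.
have TT : jmat 0 0 1 *m jmat 0 0 1 = (1 : R)%:M.
  by rewrite jmat_sqr; congr (_%:M); ring.
split; last first.
  move=> V _ p _.
  rewrite (pairing_lift_sl2 p _ II) (pairing_lift_sl2 p _ SS)
    (pairing_lift_sl2 p _ TT).
  by split; ring.
split.
- by do 2?split; exact: smooth_lift_sl2.
- by move=> p _; rewrite (lift_sl2_sqr p II) raddfN.
- by move=> p _; rewrite (lift_sl2_sqr p SS) (lift_sl2_sqr p TT).
- by move=> p _; exact: jmat_IST.
move=> a b c abc.
rewrite (_ : (fun p => _) = lift_sl2 (jmat a b c));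
  first exact: lift_jmat_integrable.
by apply/funext => p; exact: lift_jmat_linear.
Qed.
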